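(* Let $(E,\star,\rho,(\cdot,\cdot)_-)$ be a pre-symplectic algebroid. There is a one-to-one correspondence between Dirac structures of $(E,\star,\rho,(\cdot,\cdot)_-)$ and Lagrangian subalgebroids of the corresponding symplectic Lie algebroid $(E,[\cdot,\cdot]_E,\rho,\omega=(\cdot,\cdot)_-)$, where $[e_1,e_2]_E=e_1\star e_2-e_2\star e_1$ for all $e_1,e_2\in\Gamma(E)$.
   Context: All vector bundles are over the same manifold $M$; bundle maps are base-preserving and $C^\infty(M)$-linear. A Lie algebroid is a vector bundle $E\to M$ with a Lie algebra structure $[\cdot,\cdot]_E$ on $\Gamma(E)$ and a bundle map $\rho:E\to TM$ (the anchor) such that $[x,fy]_E=f[x,y]_E+\rho(x)(f)y$ for all $x,y\in\Gamma(E)$, $f\in C^\infty(M)$. A symplectic Lie algebroid is a Lie algebroid together with a nondegenerate 2-form $\omega\in\Gamma(\wedge^2E^* )$ that is closed, i.e. $\rho(x)\omega(y,z)-\rho(y)\omega(x,z)+\rho(z)\omega(x,y)-\omega([x,y]_E,z)+\omega([x,z]_E,y)-\omega([y,z]_E,x)=0$ for all $x,y,z\in\Gamma(E)$. A subalgebroid of a symplectic Lie algebroid (a subbundle whose sections are closed under the bracket, with the restricted bracket and anchor) is called Lagrangian if it is maximal isotropic with respect to $\omega$. A pre-symplectic algebroid $(E,\star,\rho,(\cdot,\cdot)_-)$ is a vector bundle $E\to M$ equipped with a nondegenerate skew-symmetric bilinear form $(\cdot,\cdot)_-$, a multiplication $\star:\Gamma(E)\times\Gamma(E)\to\Gamma(E)$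 and a bundle map $\rho:E\to TM$ such that for all $e_1,e_2,e_3\in\Gamma(E)$: (i) $(e_1,e_2,e_3)-(e_2,e_1,e_3)=\frac16 D\,T(e_1,e_2,e_3)$; (ii) $\rho(e_1)(e_2,e_3)_-=(e_1\star e_2-\frac12D(e_1,e_2)_-,\,e_3)_-+(e_2,[e_1,e_3]_E)_-$. Here $(e_1,e_2,e_3)=e_1\star(e_2\star e_3)-(e_1\star e_2)\star e_3$ is the associator; $T(e_1,e_2,e_3)=(e_1\star e_2,e_3)_-+(e_1,e_2\star e_3)_--(e_2\star e_1,e_3)_--(e_2,e_1\star e_3)_-\in C^\infty(M)$; $D:C^\infty(M)\to\Gamma(E)$ is defined by $(Df,e)_-=\rho(e)(f)$ for $f\in C^\infty(M)$, $e\in\Gamma(E)$; and $[e_1,e_2]_E=e_1\star e_2-e_2\star e_1$. For any pre-symplectic algebroid, $(E,[\cdot,\cdot]_E,\rho,\omega=(\cdot,\cdot)_-)$ is a symplectic Lie algebroid, called the corresponding symplectic Lie algebroid. A Dirac structure of $(E,\star,\rho,(\cdot,\cdot)_-)$ is a subbundle $F\subset E$ that is maximally isotropic with respect to $(\cdot,\cdot)_-$ and integrable, i.e. $\Gamma(F)$ is closed under $\star$. *)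

(* Defs.v *)
From HB Require Import structures.
From mathcomp Require Import all_boot all_order all_algebra.
From mathcomp Require Import all_classical all_reals all_analysis.
From mathcomp Require Import ring lra.

Set Implicit Arguments.
Unset Strict Implicit.
Unset Printing Implicit Defensive.

Import Order.TTheory GRing.Theory Num.Theory.
Import numFieldNormedType.Exports.

Local Open Scope classical_set_scope.
Local Open Scope ring_scope.

Section Smooth.
Variables (R : realType) (n : nat).
Implicit Types (U V : set 'rV[R]_n) (f g : 'rV[R]_n -> R) (k : nat).

(* All partial derivatives of order at most k exist on U and are continuous
   there; U is meant to be open. *)
Fixpoint Ck k U f : Prop :=
  (forall x, U x -> {for x, continuous f}) /\
  match k with
  | 0 => True
  | k'.+1 => forall i : 'I_n,
      (forall x, U x -> derivable f x (delta_mx 0 i)) /\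
      Ck k' U ('D_(delta_mx 0 i) f)
  end.

Definition smooth_on U f := forall k, Ck k U f.

Lemma Ck_cont k U f : Ck k U f -> forall x, U x -> {for x, continuous f}.
Proof. by case: k => [|k] []. Qed.

Lemma CkW k U f : Ck k.+1 U f -> Ck k U f.
Proof.
elim: k f => [|k IH] f [cf df]; first by split.
by split=> // i; have [di /IH ?] := df i.
Qed.

Lemma near_eq_continuous_at f g (x : 'rV[R]_n) :
  (\forall y \near x, g y = f y) -> {for x, continuous g} ->
  {for x, continuous f}.
Proof.
move=> gf cg; have e : g x = f x := nbhs_singleton gf.
have cg' : g @ x --> g x := cg.
have : f @ x --> f x; last by [].
rewrite -e; apply: cvg_trans cg'; exact: near_eq_cvg gf.
Qed.

Lemma Ck_local k U f : open U ->
  (forall x, U x -> exists2 g, (\forall y \near x, g y = f y) &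
     exists2 V, open V /\ V x & Ck k V g) -> Ck k U f.
Proof.
move=> oU; elim: k U f oU => [|k IH] U f oU H.
  split=> // x /H [g gf [V [oV Vx] [cg _]]].
  exact: near_eq_continuous_at gf (cg _ Vx).
split=> [x /H [g gf [V [oV Vx] [cg _]]]|i].
  exact: near_eq_continuous_at gf (cg _ Vx).
split=> [x /H [g gf [V [oV Vx] [_ /(_ i) [dg _]]]]|].
  by apply: near_eq_derivable gf _; exact: dg.
apply: IH => // x /H [g gf [V [oV Vx] [_ /(_ i) [_ dg]]]].
exists ('D_(delta_mx 0 i) g); last by exists V.
by apply: filterS (nbhs_interior gf) => y gy; apply: near_eq_derive.
Qed.

Lemma Ck_sub k U V f : V `<=` U -> Ck k U f -> Ck k V f.
Proof.
move=> VU; elim: k f => [|k IH] f [cf df]; first by split=> // x /VU /cf.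
by split=> [x /VU /cf//|i]; have [di /IH ?] := df i; split=> // x /VU /di.
Qed.

Lemma Ck_ext k U f g : open U -> (forall x, U x -> f x = g x) ->
  Ck k U f -> Ck k U g.
Proof.
move=> oU fg cf; apply: Ck_local => // x Ux; exists f; last by exists U.
have := open_nbhs_nbhs (conj oU Ux).
by apply: filterS => y /fg ->.
Qed.

Lemma Ck_cst k U (c : R) : Ck k U (cst c).
Proof.
elim: k c => [|k IH] c; first by split=> // x _; exact: cst_continuous.
split=> [x _|i]; first exact: cst_continuous.
split=> [x _|]; first exact: derivable_cst.
have -> : 'D_(delta_mx 0 i) (cst c : 'rV[R]_n -> R) = cst 0.
  by apply/funext => x; rewrite derive_cst.
exact: IH.
Qed.

Lemma Ck_add k U f g : open U -> Ck k U f -> Ck k U g -> Ck k U (f + g).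
Proof.
move=> oU; elim: k f g => [|k IH] f g [cf df] [cg dg].
  by split=> // x Ux; apply: continuousD; [exact: cf|exact: cg].
split=> [x Ux|i]; first by apply: continuousD; [exact: cf|exact: cg].
have [dfi Dfi] := df i; have [dgi Dgi] := dg i.
split=> [x Ux|]; first by apply: derivableD; [exact: dfi|exact: dgi].
apply: Ck_ext (IH _ _ Dfi Dgi) => // x Ux.
by rewrite deriveD; [|exact: dfi|exact: dgi].
Qed.

Lemma Ck_mul k U f g : open U -> Ck k U f -> Ck k U g -> Ck k U (f * g).
Proof.
move=> oU; elim: k f g => [|k IH] f g cf cg.
  by split=> // x Ux; apply: continuousM; [exact: cf.1|exact: cg.1].
have cf' := CkW cf; have cg' := CkW cg.
case: cf => cf df; case: cg => cg dg.
split=> [x Ux|i]; first by apply: continuousM; [exact: cf|exact: cg].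
have [dfi Dfi] := df i; have [dgi Dgi] := dg i.
split=> [x Ux|]; first by apply: derivableM; [exact: dfi|exact: dgi].
apply: Ck_ext (Ck_add oU (IH _ _ cf' Dgi) (IH _ _ cg' Dfi)) => // x Ux.
by rewrite deriveM; [|exact: dfi|exact: dgi].
Qed.

Lemma Ck_inv k U f : open U -> (forall x, U x -> f x != 0) ->
  Ck k U f -> Ck k U (fun x => (f x)^-1).
Proof.
move=> oU f0; elim: k => [|k IH] cf.
  by split=> // x Ux; apply: continuousV; [exact: f0|exact: cf.1].
have /IH cV := CkW cf.
case: cf => cf df.
split=> [x Ux|i]; first by apply: continuousV; [exact: f0|exact: cf].
have [dfi Dfi] := df i.
split=> [x Ux|]; first by apply: derivableV; [exact: f0|exact: dfi].
apply: Ck_ext (Ck_mul oU (Ck_cst k U (-1))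
  (Ck_mul oU (Ck_mul oU cV cV) Dfi)) => // x Ux.
rewrite deriveV; [|exact: f0|exact: dfi].
rewrite /GRing.mul /= /GRing.scale /= mulN1r mulNr; congr (- _).
by rewrite expr2 invfM.
Qed.

Lemma derive1P f x v : 'D_v f x = 'D_1 (fun t : R => f (t *: v + x)) 0.
Proof.
rewrite /derive; set g1 := fun h => h^-1 *: _; set g2 := fun h => h^-1 *: _.
suff -> : g1 = g2 by [].
by apply/funext => h; rewrite /g1 /g2 /= addr0 scale0r add0r [_%:A]mulr1.
Qed.

Lemma Ck_comp (I : Type) (h : I -> R -> R) (h' : I -> I) k U f p :
  open U -> (forall p (t : R), is_derive t 1 (h p) (h (h' p) t)) ->
  Ck k U f -> Ck k U (fun x => h p (f x)).
Proof.
move=> oU dh.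
have ch q : continuous (h q).
  move=> t; apply: differentiable_continuous; apply/derivable1_diffP.
  by have [] := dh q t.
elim: k p => [|k IH] p cf.
  split=> // x Ux; apply: (@continuous_comp _ _ _ f (h p)); first exact: cf.1.
  exact: ch.
have cf' := CkW cf.
case: cf => cf df.
split=> [x Ux|i].
  by apply: (@continuous_comp _ _ _ f (h p)); [exact: cf|exact: ch].
have [dfi Dfi] := df i.
have dcomp x : U x -> is_derive x (delta_mx 0 i) (fun x => h p (f x))
    (h (h' p) (f x) * 'D_(delta_mx 0 i) f x).
  move=> Ux; have df1 := (derivable1P _ _ _).1 (dfi _ Ux).
  have D1 : 'D_1 (fun t : R => f (t *: delta_mx 0 i + x)) 0 =
            'D_(delta_mx 0 i) f x.
    exact: esym (derive1P _ _ _).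
  have h1 : is_derive (0 : R) (1 : R) (fun t : R => f (t *: delta_mx 0 i + x))
              ('D_(delta_mx 0 i) f x) by split.
  have hc : is_derive ((fun t : R => f (t *: delta_mx 0 i + x)) 0) (1 : R) (h p)
              (h (h' p) (f x)).
    by rewrite /= scale0r add0r; exact: dh.
  have [d1 d2] := @is_derive1_comp R (h p) (fun t : R => f (t *: delta_mx 0 i + x)) 0 _ _ hc h1.
  split; first exact: (derivable1P (fun x => h p (f x)) x _).2 d1.
  by rewrite -[h (h' p) _ * _]d2 derive1P.
split=> [x Ux|]; first by have [] := dcomp _ Ux.
apply: Ck_ext (Ck_mul oU (IH (h' p) cf') Dfi) => // x Ux.
by have [_ ->] := dcomp _ Ux.
Qed.

End Smooth.

(* The functions p(1/t) exp(-1/t), extended by 0 to t <= 0, are closed under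
   derivation; they provide the smooth bump functions. *)
Section Flat.
Variable R : realType.

Definition flat (p : {poly R}) (t : R) : R :=
  if 0 < t then p.[t^-1] * expR (- t^-1) else 0.

Definition flat' (p : {poly R}) : {poly R} := 'X^2 * (p - p^`()).


Lemma flat_le (q : {poly R}) : exists2 C : R, 0 <= C &
  forall h, 0 < h -> `|q.[h^-1] * expR (- h^-1)| <= C * h.
Proof.
exists (\sum_(i < size q) `|q`_i| * i.+1`!%:R).
  by apply: sumr_ge0 => i _; rewrite mulr_ge0.
move=> h h0; rewrite horner_coef mulr_suml mulr_suml.
apply: le_trans (ler_norm_sum _ _ _) _; apply: ler_sum => i _.
rewrite -!mulrA !normrM ler_wpM2l //.
have s0 : 0 < h^-1 by rewrite invr_gt0.
rewrite !ger0_norm ?expR_ge0 ?exprn_ge0 ?(ltW s0) //.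
rewrite expRN ler_pdivrMr ?expR_gt0 //.
have := @expR_ge1Dxn R h^-1 i (ltW s0).
set E := expR _ => HE.
have f0 : 0 < i.+1`!%:R :> R by rewrite ltr0n fact_gt0.
have {}HE : h^-1 ^+ i.+1 <= E * i.+1`!%:R.
  by rewrite -ler_pdivrMr //; lra.
have -> : h^-1 ^+ i = h * h^-1 ^+ i.+1 by rewrite exprS mulVKf // gt_eqF.
by rewrite -mulrA [leRHS]mulrCA ler_wpM2l ?(ltW h0) // mulrC.
Qed.

Lemma flat_is_derive p (t : R) : is_derive t 1 (flat p) (flat (flat' p) t).
Proof.
have [t0|t0|->] := ltgtP t 0.
- have -> : flat (flat' p) t = 0 by rewrite /flat ltNge ltW.
  apply: (@near_eq_is_derive _ R R (cst 0) _ _ _ _ _ (is_derive_cst (0 : R) t 1)).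
    near=> y; rewrite /flat ltNge ltW //.
    by near: y; exact: lt_nbhsl.
- have -> : flat (flat' p) t = (flat' p).[t^-1] * expR (- t^-1) by rewrite /flat t0.
  apply: (@near_eq_is_derive _ R R (fun y : R => p.[y^-1] * expR (- y^-1))).
    near=> y; rewrite /flat ifT //.
    by near: y; exact: lt_nbhsr.
  have t1 : t != 0 by rewrite gt_eqF.
  have dV : is_derive t 1 (fun y : R => y^-1) (- t^-1 ^+ 2).
    split; first by apply: derivableV.
    by rewrite deriveV // derive_id /GRing.scale /= mulr1 exprVn.
  have dN : is_derive t 1 (fun y : R => - y^-1) (t^-1 ^+ 2).
    by rewrite -[t^-1 ^+ 2]opprK; exact: is_deriveN.
  have dp : is_derive t^-1 1 (horner p) (p^`()).[t^-1].
    by split; [exact: derivable_horner|rewrite -derive1E -derivE].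
  have d1 := @is_derive1_comp R (horner p) (fun y => y^-1) t _ _ dp dV.
  have d2 := @is_derive1_comp R (@expR R) (fun y => - y^-1) t _ _ (is_derive_expR _) dN.
  apply: (is_derive_eq (is_deriveM d1 d2)).
  rewrite /flat' /GRing.scale /= !hornerE /=; ring.
have -> : flat (flat' p) 0 = 0 by rewrite /flat ltxx.
have [C C0 HC] := flat_le ('X * p).
have cvC : C * `|h| @[h --> (0 : R)^'] --> (0 : R).
  have H : C * `|h| @[h --> (0 : R)^'] --> C * `|0 : R|.
    apply: cvgM; first exact: cvg_cst.
    by apply: cvg_within_filter; exact: norm_continuous.
  by rewrite normr0 mulr0 in H.
have cv : h^-1 *: ((flat p \o shift 0) (h *: 1) - flat p 0) @[h --> (0 : R)^'] --> (0 : R).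
  apply: (@squeeze_cvgr _ _ _ _ (fun h => - (C * `|h|)) (fun h => C * `|h|)).
  - near=> h; have h0 : h != 0 by near: h; exact: nbhs_dnbhs_neq.
    rewrite -ler_norml /= addr0 {2}/flat ltxx subr0 /GRing.scale /= mulr1 /flat.
    case: ifPn => hp; last by rewrite mulr0 normr0 mulr_ge0.
    rewrite [`|h|]ger0_norm ?(ltW hp) //.
    by have := HC _ hp; rewrite hornerM hornerX mulrA.
  - by have := cvgN cvC; rewrite oppr0; apply.
  - exact: cvC.
by split; [apply/cvg_ex; exists 0|exact: cvg_lim cv].
Unshelve. all: by end_near. Qed.

End Flat.

Section Box.
Variables (R : realType) (n : nat).

Definition cbox (c : 'rV[R]_n) (e : R) : set 'rV[R]_n :=
  [set y | forall i, y 0 i \in `[c 0 i - e, c 0 i + e]].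

Lemma cbox_compact c e : compact (cbox c e).
Proof.
exact: (@rV_compact R n (fun i => [set` `[c 0 i - e, c 0 i + e]]) (fun i => @segment_compact R _ _)).
Qed.

Lemma nbhs_cbox (c : 'rV[R]_n) (A : set 'rV[R]_n) : nbhs c A ->
  exists2 e : R, 0 < e & cbox c e `<=` A.
Proof.
move=> /nbhs_ballP[e /= e0 eA]; exists (e / 2); first by rewrite divr_gt0.
move=> y Hy; apply: eA; rewrite /ball /= /mx_ball; split=> // i j.
rewrite ord1; have := Hy j; rewrite /= in_itv /= => /andP[h1 h2].
by rewrite /ball /= ltr_norml; apply/andP; split; lra.
Qed.

End Box.

Record chart (R : realType) (n : nat) (T : topologicalType) := Chart {
  cdom : set T;
  cfwd : T -> 'rV[R]_n;
  cbwd : 'rV[R]_n -> T;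
  cdom_open : open cdom;
  cimg_open : open (cfwd @` cdom);
  cfwdK : forall x, cdom x -> cbwd (cfwd x) = x;
  cfwd_cont : forall x, cdom x -> {for x, continuous cfwd};
  cbwd_cont : forall y, (cfwd @` cdom) y -> {for y, continuous cbwd}
}.

(* The atlas need not be maximal: smoothness with respect to an atlas and
   with respect to the maximal atlas containing it coincide. *)
Record manifold (R : realType) (n : nat) := Manifold {
  mspace :> topologicalType;
  atlas : set (chart R n mspace);
  manifold_hausdorff : hausdorff_space mspace;
  manifold_second_countable : @second_countable mspace;
  atlas_cover : forall x : mspace, exists2 c, atlas c & cdom c x;
  atlas_compat : forall c d, atlas c -> atlas d -> forall i,
    smooth_on (cfwd c @` (cdom c `&` cdom d))
              (fun y => cfwd d (cbwd c y) 0 i)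
}.

Section SmoothFunctions.
Variables (R : realType) (n : nat) (M : manifold R n).
Implicit Types (W V : set M) (f g : M -> R).

(* Smoothness of f on an open subset W of M. *)
Definition msmooth W f := forall c, atlas c ->
  smooth_on (cfwd c @` (cdom c `&` W)) (f \o cbwd c).

Lemma chart_open (c : chart R n M) W : open W ->
  open (cfwd c @` (cdom c `&` W)).
Proof.
move=> oW; rewrite openE => _ [x [cx Wx] <-].
have iy : (cfwd c @` cdom c) (cfwd c x) by exists x.
have n1 := open_nbhs_nbhs (conj (@cimg_open _ _ _ c) iy).
have n2 : nbhs (cfwd c x) (cbwd c @^-1` W).
  apply: (cbwd_cont iy); rewrite cfwdK //.
  exact: open_nbhs_nbhs.
apply: filterS (filterI n1 n2) => y [[z cz zy] Wy].
by exists z => //; split=> //; rewrite -(cfwdK cz) zy.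
Qed.

Lemma msmooth_local W f : open W ->
  (forall x, W x -> exists2 g, (\forall y \near x, g y = f y) &
     exists2 V, open V /\ V x & msmooth V g) -> msmooth W f.
Proof.
move=> oW H c Ac k; apply: Ck_local; first exact: chart_open.
move=> _ [x [cx Wx] <-]; have [g gf [V [oV Vx] sg]] := H _ Wx.
have iy : (cfwd c @` cdom c) (cfwd c x) by exists x.
exists (g \o cbwd c).
  have := cbwd_cont iy; rewrite /prop_for /continuous_at cfwdK //.
  by move=> cb; exact: (cb _ gf).
exists (cfwd c @` (cdom c `&` V)); last exact: sg.
by split; [exact: chart_open|exists x].
Qed.

Lemma msmooth_sub W V f : V `<=` W -> msmooth W f -> msmooth V f.
Proof.
move=> VW sf c Ac k; apply: Ck_sub (sf c Ac k) => _ [x [cx Vx] <-].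
by exists x => //; split=> //; exact: VW.
Qed.

Lemma msmooth_ext W f g : open W -> (forall x, W x -> f x = g x) ->
  msmooth W f -> msmooth W g.
Proof.
move=> oW fg sf; apply: msmooth_local => // x Wx; exists f; last by exists W.
by apply: filterS (open_nbhs_nbhs (conj oW Wx)) => y /fg.
Qed.

Lemma msmooth_cst W (a : R) : msmooth W (fun=> a).
Proof. by move=> c Ac k; exact: Ck_cst. Qed.

Lemma msmoothD W f g : open W -> msmooth W f -> msmooth W g ->
  msmooth W (fun x => f x + g x).
Proof.
by move=> oW sf sg c Ac k; apply: Ck_add (sf c Ac k) (sg c Ac k); exact: chart_open.
Qed.

Lemma msmoothM W f g : open W -> msmooth W f -> msmooth W g ->
  msmooth W (fun x => f x * g x).
Proof.
by move=> oW sf sg c Ac k; apply: Ck_mul (sf c Ac k) (sg c Ac k); exact: chart_open.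
Qed.

Lemma msmoothN W f : open W -> msmooth W f -> msmooth W (fun x => - f x).
Proof.
move=> oW sf.
apply: msmooth_ext (msmoothM oW (msmooth_cst W (-1)) sf) => // x _.
by rewrite mulN1r.
Qed.

Lemma msmoothV W f : open W -> (forall x, W x -> f x != 0) -> msmooth W f ->
  msmooth W (fun x => (f x)^-1).
Proof.
move=> oW f0 sf c Ac k; apply: (@Ck_inv _ _ _ _ (f \o cbwd c)).
- exact: chart_open.
- by move=> _ [x [cx Wx] <-] /=; rewrite cfwdK //; exact: f0.
- exact: sf.
Qed.

Lemma msmooth_sum W (I : Type) (r : seq I) (P : pred I) (F : I -> M -> R) :
  open W -> (forall i, msmooth W (F i)) ->
  msmooth W (fun x => \sum_(i <- r | P i) F i x).
Proof.
move=> oW sF; elim: r => [|i r IH].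
  by apply: msmooth_ext (msmooth_cst W 0) => // x _; rewrite big_nil.
case Pi: (P i); last first.
  by apply: msmooth_ext IH => // x _; rewrite big_cons Pi.
by apply: msmooth_ext (msmoothD oW (sF i) IH) => // x _; rewrite big_cons Pi.
Qed.

Lemma msmooth_prod W (I : Type) (r : seq I) (F : I -> M -> R) :
  open W -> (forall i, msmooth W (F i)) ->
  msmooth W (fun x => \prod_(i <- r) F i x).
Proof.
move=> oW sF; elim: r => [|i r IH].
  by apply: msmooth_ext (msmooth_cst W 1) => // x _; rewrite big_nil.
by apply: msmooth_ext (msmoothM oW (sF i) IH) => // x _; rewrite big_cons.
Qed.

Lemma msmooth_det W m (A : M -> 'M[R]_m) : open W ->
  (forall i j, msmooth W (fun x => A x i j)) -> msmooth W (fun x => \det (A x)).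
Proof.
move=> oW sA; rewrite /determinant; apply: msmooth_sum => // s.
by apply: msmoothM => //; [exact: msmooth_cst|exact: msmooth_prod].
Qed.

Lemma msmooth_adj W m (A : M -> 'M[R]_m) : open W ->
  (forall i j, msmooth W (fun x => A x i j)) ->
  forall i j, msmooth W (fun x => \adj (A x) i j).
Proof.
move=> oW sA i j.
apply: (@msmooth_ext _ (fun x => (-1) ^+ (j + i) * \det (row' j (col' i (A x))))) => //.
  by move=> x _; rewrite mxE.
apply: msmoothM => //; first exact: msmooth_cst.
apply: msmooth_det => // k l.
by apply: msmooth_ext (sA (lift j k) (lift i l)) => // x _; rewrite !mxE.
Qed.

Lemma msmooth_cont W f x : open W -> msmooth W f -> W x ->
  {for x, continuous f}.
Proof.
move=> oW sf Wx; have [c Ac cx] := atlas_cover x.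
have cf : {for cfwd c x, continuous (f \o cbwd c)}.
  by apply: (Ck_cont (sf c Ac 0%N)); exists x.
have cg := @continuous_comp _ _ _ _ _ _ (cfwd_cont cx) cf.
have : f @ x --> f x; last by [].
have cg' : (f \o cbwd c \o cfwd c) @ x --> f x.
  by have := cg; rewrite /prop_for /continuous_at /= cfwdK.
apply: cvg_trans cg'; apply: near_eq_cvg.
apply: filterS (open_nbhs_nbhs (conj (@cdom_open _ _ _ c) cx)) => y cy /=.
by rewrite cfwdK.
Qed.

Lemma smooth_bump W (x0 : M) : open W -> W x0 -> exists f, exists2 K,
  closed K /\ K `<=` W &
  [/\ msmooth setT f, f x0 = 1 & forall x, f x != 0 -> K x].
Proof.
move=> oW Wx0; have [c Ac cx] := atlas_cover x0.
set y0 := cfwd c x0.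
have Ay0 : (cfwd c @` (cdom c `&` W)) y0 by exists x0.
have [e e0 eA] := nbhs_cbox (open_nbhs_nbhs (conj (@chart_open c W oW) Ay0)).
pose F i x := flat 1 (e ^+ 2 - (cfwd c x 0 i - y0 0 i) ^+ 2).
pose G x := \prod_i F i x.
pose f := fun x => if x \in cdom c then G x else 0.
pose K := cbwd c @` cbox y0 e.
have cK : closed K.
  apply: compact_closed; first exact: manifold_hausdorff.
  apply: continuous_compact; last exact: cbox_compact.
  apply: continuous_in_subspaceT => y; rewrite inE => /eA [x [dx _] <-].
  by apply: cbwd_cont; exists x.
have KW : K `<=` W.
  by move=> _ [y /eA [x [dx Wx] <-] <-]; rewrite cfwdK.
have fK x : f x != 0 -> K x.
  rewrite /f; case: ifP; last by rewrite eqxx.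
  rewrite inE => dx G0; exists (cfwd c x); last exact: cfwdK.
  move=> i; have : F i x != 0.
    by apply: contra G0 => /eqP Fi; rewrite /G (bigD1 i) //= Fi mul0r.
  rewrite /F /flat; case: ifPn => [+ _|]; last by rewrite eqxx.
  rewrite subr_gt0 => lt; rewrite in_itv /=.
  have : `|cfwd c x 0 i - y0 0 i| < e.
    by rewrite -(ltr_pXn2r (n := 2)) ?nnegrE ?(ltW e0) // real_normK ?num_real.
  by rewrite ltr_norml => /andP[? ?]; apply/andP; split; lra.
have G0 : G x0 != 0.
  apply/prodf_neq0 => i _.
  rewrite /F /y0 subrr expr0n subr0 /flat exprn_gt0 // hornerC mul1r.
  by rewrite gt_eqF // expR_gt0.
have sG : msmooth (cdom c) G.
  apply: msmooth_prod => [|i]; first exact: cdom_open.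
  move=> d Ad k; apply: (@Ck_comp _ _ _ (@flat R) (@flat' R) k _
    (fun y => e ^+ 2 - (cfwd c (cbwd d y) 0 i - y0 0 i) ^+ 2)).
  - by apply: chart_open; exact: cdom_open.
  - exact: flat_is_derive.
  have sc : msmooth (cdom c) (fun x => cfwd c x 0 i).
    by move=> d' Ad' k'; exact: atlas_compat.
  have oc := @cdom_open _ _ _ c.
  have sd := msmoothD oc sc (msmooth_cst _ (- y0 0 i)).
  have := msmoothD oc (msmooth_cst _ (e ^+ 2)) (msmoothN oc (msmoothM oc sd sd)).
  exact.
have sf : msmooth setT f.
  apply: msmooth_local; first exact: openT.
  move=> x _; have [dx|dx] := pselect (cdom c x).
    exists G; last by exists (cdom c) => //; split=> //; exact: cdom_open.
    apply: filterS (open_nbhs_nbhs (conj (@cdom_open _ _ _ c) dx)) => y dy.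
    by rewrite /f ifT // inE.
  exists (fun=> 0); last by exists setT; [split=> //; exact: openT|exact: msmooth_cst].
  have nK : ~ K x by move=> [y /eA [z [dz _] <-]]; rewrite cfwdK // => zx; rewrite zx in dz.
  have oK : open (~` K) by exact: closed_openC.
  apply: filterS (open_nbhs_nbhs (conj oK nK)) => y Ky.
  by apply/eqP; rewrite eq_sym; apply: contra_notT Ky; exact: fK.
exists (fun x => (G x0)^-1 * f x), K => //; split.
- by apply: msmoothM => //; [exact: openT|exact: msmooth_cst].
- by rewrite /f ifT ?inE // mulVf.
- by move=> x; rewrite mulf_eq0 negb_or => /andP[_ /fK].
Qed.

End SmoothFunctions.

Record Cinf (R : realType) (n : nat) (M : manifold R n) := MkCinf {
  cval :> M -> R;
  cvalP : msmooth setT cval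
}.

Section CinfAlgebra.
Variables (R : realType) (n : nat) (M : manifold R n).
Implicit Types f g : Cinf M.

Lemma Cinf_ext f g : f =1 g -> f = g.
Proof.
case: f g => [f pf] [g pg] /= /funext fg; case: _ / fg pg => pg.
by congr MkCinf; exact: Prop_irrelevance.
Qed.

HB.instance Definition _ := gen_eqMixin (Cinf M).
HB.instance Definition _ := gen_choiceMixin (Cinf M).

Definition Cinf_cst (a : R) : Cinf M := MkCinf (@msmooth_cst R n M setT a).
Definition Cinf_add f g : Cinf M :=
  MkCinf (msmoothD openT (cvalP f) (cvalP g)).
Definition Cinf_opp f : Cinf M := MkCinf (msmoothN openT (cvalP f)).
Definition Cinf_mul f g : Cinf M :=
  MkCinf (msmoothM openT (cvalP f) (cvalP g)).
Definition Cinf_scale (a : R) f : Cinf M := Cinf_mul (Cinf_cst a) f.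

Fact Cinf_addA : associative Cinf_add.
Proof. by move=> f g h; apply: Cinf_ext => x /=; rewrite addrA. Qed.
Fact Cinf_addC : commutative Cinf_add.
Proof. by move=> f g; apply: Cinf_ext => x /=; rewrite addrC. Qed.
Fact Cinf_add0 : left_id (Cinf_cst 0) Cinf_add.
Proof. by move=> f; apply: Cinf_ext => x /=; rewrite add0r. Qed.
Fact Cinf_addN : left_inverse (Cinf_cst 0) Cinf_opp Cinf_add.
Proof. by move=> f; apply: Cinf_ext => x /=; rewrite addNr. Qed.
HB.instance Definition _ :=
  GRing.isZmodule.Build (Cinf M) Cinf_addA Cinf_addC Cinf_add0 Cinf_addN.

Fact Cinf_mulA : associative Cinf_mul.
Proof. by move=> f g h; apply: Cinf_ext => x /=; rewrite mulrA. Qed.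
Fact Cinf_mulC : commutative Cinf_mul.
Proof. by move=> f g; apply: Cinf_ext => x /=; rewrite mulrC. Qed.
Fact Cinf_mul1 : left_id (Cinf_cst 1) Cinf_mul.
Proof. by move=> f; apply: Cinf_ext => x /=; rewrite mul1r. Qed.
Fact Cinf_mulD : left_distributive Cinf_mul +%R.
Proof. by move=> f g h; apply: Cinf_ext => x /=; rewrite mulrDl. Qed.
HB.instance Definition _ :=
  GRing.Zmodule_isComPzRing.Build (Cinf M) Cinf_mulA Cinf_mulC Cinf_mul1 Cinf_mulD.

Fact Cinf_scaleA (a b : R) f :
  Cinf_scale a (Cinf_scale b f) = Cinf_scale (a * b) f.
Proof. by apply: Cinf_ext => x /=; rewrite mulrA. Qed.
Fact Cinf_scale1 : left_id 1 Cinf_scale.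
Proof. by move=> f; apply: Cinf_ext => x /=; rewrite mul1r. Qed.
Fact Cinf_scaleDr : right_distributive Cinf_scale +%R.
Proof. by move=> a f g; apply: Cinf_ext => x /=; rewrite mulrDr. Qed.
Fact Cinf_scaleDl f : {morph Cinf_scale^~ f : a b / a + b}.
Proof. by move=> a b; apply: Cinf_ext => x /=; rewrite mulrDl. Qed.
HB.instance Definition _ :=
  GRing.Zmodule_isLmodule.Build R (Cinf M)
    Cinf_scaleA Cinf_scale1 Cinf_scaleDr Cinf_scaleDl.

End CinfAlgebra.

(* T_x M is the space of derivations at x of the algebra of smooth functions. *)
Record tangent (R : realType) (n : nat) (M : manifold R n) (x : M) :=
  MkTangent {
    tval :> Cinf M -> R;
    tval_linear : forall (a : R) f g, tval (a *: f + g) = a * tval f + tval g;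
    tval_leibniz : forall f g, tval (f * g) = tval f * g x + f x * tval g
  }.

Section TangentModule.
Variables (R : realType) (n : nat) (M : manifold R n) (x : M).
Implicit Types X Y : tangent x.

Lemma tangent_ext X Y : X =1 Y -> X = Y.
Proof.
case: X Y => [f p q] [g p' q'] /= /funext fg; case: _ / fg p' q' => p' q'.
by congr MkTangent; exact: Prop_irrelevance.
Qed.

HB.instance Definition _ := gen_eqMixin (tangent x).
HB.instance Definition _ := gen_choiceMixin (tangent x).

Definition tangent0 : tangent x.
Proof. by exists (fun=> 0) => *; ring. Defined.

Definition tangent_add X Y : tangent x.
Proof.
by exists (fun f => X f + Y f) => *; rewrite ?tval_linear ?tval_leibniz; ring.
Defined.

Definition tangent_scale (a : R) X : tangent x.
Proof.
by exists (fun f => a * X f) => *; rewrite ?tval_linear ?tval_leibniz; ring.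
Defined.

Definition tangent_opp X : tangent x := tangent_scale (-1) X.

Fact tangent_addA : associative tangent_add.
Proof. by move=> X Y Z; apply: tangent_ext => f /=; rewrite addrA. Qed.
Fact tangent_addC : commutative tangent_add.
Proof. by move=> X Y; apply: tangent_ext => f /=; rewrite addrC. Qed.
Fact tangent_add0 : left_id tangent0 tangent_add.
Proof. by move=> X; apply: tangent_ext => f /=; rewrite add0r. Qed.
Fact tangent_addN : left_inverse tangent0 tangent_opp tangent_add.
Proof. by move=> X; apply: tangent_ext => f /=; rewrite mulN1r addNr. Qed.
HB.instance Definition _ := GRing.isZmodule.Build (tangent x)
  tangent_addA tangent_addC tangent_add0 tangent_addN.

Fact tangent_scaleA (a b : R) X :
  tangent_scale a (tangent_scale b X) = tangent_scale (a * b) X.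
Proof. by apply: tangent_ext => f /=; rewrite mulrA. Qed.
Fact tangent_scale1 : left_id 1 tangent_scale.
Proof. by move=> X; apply: tangent_ext => f /=; rewrite mul1r. Qed.
Fact tangent_scaleDr : right_distributive tangent_scale +%R.
Proof. by move=> a X Y; apply: tangent_ext => f /=; rewrite mulrDr. Qed.
Fact tangent_scaleDl X : {morph tangent_scale^~ X : a b / a + b}.
Proof. by move=> a b; apply: tangent_ext => f /=; rewrite mulrDl. Qed.
HB.instance Definition _ := GRing.Zmodule_isLmodule.Build R (tangent x)
  tangent_scaleA tangent_scale1 tangent_scaleDr tangent_scaleDl.

End TangentModule.

Record trivialization (R : realType) (n : nat) (M : manifold R n)
    (fib : M -> lmodType R) (r : nat) := Trivialization {
  tdom : set M;
  tmap : forall x, {linear fib x -> 'rV[R]_r};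
  tdom_open : open tdom;
  tmap_bij : forall x, tdom x -> bijective (tmap x)
}.

(* A smooth vector bundle of rank r, given by its fibres and a bundle atlas
   with smooth transition matrices; these data determine the topology and the
   smooth structure of the total space. *)
Record vbundle (R : realType) (n : nat) (M : manifold R n) (r : nat) :=
  VBundle {
    fib :> M -> lmodType R;
    trivs : set (trivialization fib r);
    trivs_cover : forall x, exists2 a, trivs a & tdom a x;
    trivs_compat : forall a b, trivs a -> trivs b ->
      exists2 g : M -> 'M[R]_r,
        forall i j, msmooth (tdom a `&` tdom b) (fun x => g x i j) &
        forall x (v : fib x), tdom a x -> tdom b x ->
          tmap b x v = tmap a x v *m g x
  }.

Section Sections.
Variables (R : realType) (n : nat) (M : manifold R n) (r : nat).
Variable E : vbundle M r.

(* Smoothness of the section s over an open subset W of M. *)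
Definition ssmooth (W : set M) (s : forall x, E x) :=
  forall a, trivs a -> forall i,
    msmooth (tdom a `&` W) (fun x => tmap a x (s x) 0 i).

Record Gamma := MkGamma {
  gval :> forall x, E x;
  gvalP : ssmooth setT gval
}.

Lemma Gamma_ext (s t : Gamma) : (forall x, s x = t x) -> s = t.
Proof.
case: s t => [s ps] [t pt] /= st.
have {}st : s = t by exact: functional_extensionality_dep.
by case: _ / st pt => pt; congr MkGamma; exact: Prop_irrelevance.
Qed.

HB.instance Definition _ := gen_eqMixin Gamma.
HB.instance Definition _ := gen_choiceMixin Gamma.

Lemma tdomT_open (a : trivialization E r) : open (tdom a `&` setT).
Proof. by rewrite setIT; exact: tdom_open. Qed.

Fact ssmooth0 : ssmooth setT (fun=> 0).
Proof.
move=> a ta i; apply: msmooth_ext (@msmooth_cst _ _ _ _ 0) => [|x _].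
  exact: tdomT_open.
by rewrite linear0 mxE.
Qed.

Fact ssmooth_add (s t : Gamma) : ssmooth setT (fun x => s x + t x).
Proof.
move=> a ta i; have o := @tdomT_open a.
apply: msmooth_ext (msmoothD o (gvalP s ta i) (gvalP t ta i)) => // x _.
by rewrite linearD mxE.
Qed.

Fact ssmooth_fscale (f : Cinf M) (s : Gamma) : ssmooth setT (fun x => f x *: s x).
Proof.
move=> a ta i; have o := @tdomT_open a.
have sf : msmooth (tdom a `&` setT) f.
  by apply: msmooth_sub (cvalP f).
apply: msmooth_ext (msmoothM o sf (gvalP s ta i)) => // x _.
by rewrite linearZ mxE.
Qed.

(* The C^oo(M)-module structure of Gamma E; the canonical lmodType structure
   of Gamma E below is the one over the constants R. *)
Definition fscale (f : Cinf M) (s : Gamma) : Gamma := MkGamma (ssmooth_fscale f s).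

Definition Gamma0 : Gamma := MkGamma ssmooth0.
Definition Gamma_add (s t : Gamma) : Gamma := MkGamma (ssmooth_add s t).
Definition Gamma_scale (a : R) (s : Gamma) : Gamma := fscale (Cinf_cst M a) s.
Definition Gamma_opp (s : Gamma) : Gamma := Gamma_scale (-1) s.

Fact Gamma_addA : associative Gamma_add.
Proof. by move=> s t u; apply: Gamma_ext => x /=; rewrite addrA. Qed.
Fact Gamma_addC : commutative Gamma_add.
Proof. by move=> s t; apply: Gamma_ext => x /=; rewrite addrC. Qed.
Fact Gamma_add0 : left_id Gamma0 Gamma_add.
Proof. by move=> s; apply: Gamma_ext => x /=; rewrite add0r. Qed.
Fact Gamma_addN : left_inverse Gamma0 Gamma_opp Gamma_add.
Proof. by move=> s; apply: Gamma_ext => x /=; rewrite scaleN1r addNr. Qed.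
HB.instance Definition _ :=
  GRing.isZmodule.Build Gamma Gamma_addA Gamma_addC Gamma_add0 Gamma_addN.

Fact Gamma_scaleA (a b : R) (s : Gamma) :
  Gamma_scale a (Gamma_scale b s) = Gamma_scale (a * b) s.
Proof. by apply: Gamma_ext => x /=; rewrite scalerA. Qed.
Fact Gamma_scale1 : left_id 1 Gamma_scale.
Proof. by move=> s; apply: Gamma_ext => x /=; rewrite scale1r. Qed.
Fact Gamma_scaleDr : right_distributive Gamma_scale +%R.
Proof. by move=> a s t; apply: Gamma_ext => x /=; rewrite scalerDr. Qed.
Fact Gamma_scaleDl (s : Gamma) : {morph Gamma_scale^~ s : a b / a + b}.
Proof. by move=> a b; apply: Gamma_ext => x /=; rewrite scalerDl. Qed.
HB.instance Definition _ := GRing.Zmodule_isLmodule.Build R Gamma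
  Gamma_scaleA Gamma_scale1 Gamma_scaleDr Gamma_scaleDl.

(* A bundle map from E to TM; a vector field X on M is smooth iff X f is
   smooth for all smooth functions f. *)
Record anchor := MkAnchor {
  anc :> forall x, {linear E x -> tangent x};
  anc_smooth : forall (e : Gamma) (f : Cinf M),
    msmooth setT (fun x => anc x (e x) f)
}.

Definition anchor_act (rho : anchor) (e : Gamma) (f : Cinf M) : Cinf M :=
  MkCinf (anc_smooth rho e f).

(* A 2-form is smooth iff its value on any two smooth sections is smooth. *)
Record form2 := MkForm2 {
  form2_val :> forall x, E x -> E x -> R;
  form_linear : forall x (a : R) (u v w : E x),
    form2_val (a *: u + v) w = a * form2_val u w + form2_val v w;
  form_skew : forall x (u v : E x), form2_val u v = - form2_val v u;
  form_smooth : forall s t : Gamma, msmooth setT (fun x => form2_val (s x) (t x))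
}.

Arguments form2_val _ x u v : clear implicits.

Definition pairing (w : form2) (s t : Gamma) : Cinf M :=
  MkCinf (form_smooth w s t).

Definition nondegenerate (w : form2) :=
  forall x (u : E x), (forall v, w x u v = 0) -> u = 0.

(* D f is the section such that (D f, e)_- = rho(e)(f) for all e; for a
   nondegenerate form it exists and is unique, see gradP and gradU. *)
Definition grad (w : form2) (rho : anchor) (f : Cinf M) : Gamma :=
  xget 0 [set s | forall e, pairing w s e = anchor_act rho e f].

End Sections.
Arguments form2_val {R n M r E} _ x u v.

Section LocalFrames.
Variables (R : realType) (n : nat) (M : manifold R n) (r : nat).
Variable E : vbundle M r.

Lemma extend_section (a : trivialization E r) (x0 : M) (v : 'rV[R]_r) :
  trivs a -> tdom a x0 -> forall (f : M -> R) (K : set M),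
  closed K -> K `<=` tdom a -> msmooth setT f ->
  (forall x, f x != 0 -> K x) ->
  exists e : Gamma E, forall x, tdom a x -> tmap a x (e x) = f x *: v.
Proof.
move=> ta ax0 f K cK Ka sf fK.
have inv x : exists w : E x, tdom a x -> tmap a x w = v.
  have [ax|nax] := pselect (tdom a x); last by exists 0.
  by have [g _ gK] := tmap_bij ax; exists (g v) => _; exact: gK.
pose s x : E x := f x *: projT1 (cid (inv x)).
have sE x : tdom a x -> tmap a x (s x) = f x *: v.
  by move=> ax; rewrite linearZ /= (projT2 (cid (inv x)) ax).
suff ss : ssmooth setT s by exists (MkGamma ss).
move=> b tb i; rewrite setIT.
apply: msmooth_local => [|x bx]; first exact: tdom_open.
have [ax|nax] := pselect (tdom a x).
  have [g sg gE] := trivs_compat ta tb.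
  have oab : open (tdom a `&` tdom b) by apply: openI; exact: tdom_open.
  exists (fun y => f y * (v *m g y) 0 i).
    apply: filterS (open_nbhs_nbhs (conj oab (conj ax bx))) => y [ay by_].
    by rewrite (gE y (s y)) // sE // -scalemxAl [RHS]mxE.
  exists (tdom a `&` tdom b) => //; apply: msmoothM => //.
    by apply: msmooth_sub sf.
  apply: (@msmooth_ext _ _ _ _ (fun y => \sum_j v 0 j * g y j i)) => //.
    by move=> y _; rewrite mxE.
  by apply: msmooth_sum => // j; apply: msmoothM => //; exact: msmooth_cst.
exists (fun=> 0); last first.
  by exists setT; [split=> //; exact: openT|exact: msmooth_cst].
have nK : ~ K x by move=> /Ka.
have oK : open (~` K) by exact: closed_openC.
apply: filterS (open_nbhs_nbhs (conj oK nK)) => y Ky.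
have fy : f y = 0 by apply/eqP; apply: contra_notT Ky; exact: fK.
by rewrite /s fy scale0r linear0 mxE.
Qed.

Lemma local_frame (a : trivialization E r) (x0 : M) : trivs a -> tdom a x0 ->
  exists (f : Cinf M) (e : 'I_r -> Gamma E),
    [/\ f x0 = 1, forall x, f x != 0 -> tdom a x &
     forall x i, tdom a x -> tmap a x (e i x) = f x *: delta_mx 0 i].
Proof.
move=> ta ax0; have [f [K [cK Ka] [sf f1 fK]]] := smooth_bump (@tdom_open _ _ _ _ _ a) ax0.
exists (MkCinf sf).
have H i := @extend_section a x0 (delta_mx 0 i) ta ax0 f K cK Ka sf fK.
exists (fun i => projT1 (cid (H i))); split=> // [x /fK /Ka //|x i ax].
exact: projT2 (cid (H i)) x ax.
Qed.

Lemma section_through (x : M) (v : E x) : exists e : Gamma E, e x = v.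
Proof.
have [a ta ax] := trivs_cover E x.
have [f [K [cK Ka] [sf f1 fK]]] := smooth_bump (@tdom_open _ _ _ _ _ a) ax.
have [e He] := @extend_section a x (tmap a x v) ta ax f K cK Ka sf fK.
exists e; apply: (bij_inj (tmap_bij ax)).
by rewrite He // f1 scale1r.
Qed.

Lemma frame_span (a : trivialization E r) (x : M) (c : R)
    (e : 'I_r -> E x) : tdom a x ->
  (forall i, tmap a x (e i) = c *: delta_mx 0 i) ->
  forall v, c *: v = \sum_i tmap a x v 0 i *: e i.
Proof.
move=> ax He v; apply: (bij_inj (tmap_bij ax)).
rewrite linearZ linear_sum /= [in LHS](row_sum_delta (tmap a x v)) scaler_sumr.
by apply: eq_bigr => i _; rewrite [in RHS]linearZ /= He !scalerA mulrC.
Qed.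

Variables (w : form2 E).

Lemma form_linear_l x (u : E x) : linear (fun v => w x v u : R^o).
Proof. by move=> c v v'; rewrite form_linear. Qed.
Lemma form_linear_r x (u : E x) : linear (fun v => w x u v : R^o).
Proof.
by move=> c v v'; rewrite form_skew form_linear opprD -mulrN -!form_skew.
Qed.

Lemma form_suml x (u : E x) (c : 'I_r -> R) (e : 'I_r -> E x) :
  w x (\sum_i c i *: e i) u = \sum_i c i * w x (e i) u.
Proof.
pose F := GRing.isLinear.Build R (E x) R^o *:%R _ (form_linear_l u).
pose L : {linear E x -> R^o} := HB.pack (fun v => w x v u : R^o) F.
rewrite -[LHS]/(L _) linear_sum; apply: eq_bigr => i _.
by rewrite linearZ.
Qed.

Lemma form_sumr x (u : E x) (c : 'I_r -> R) (e : 'I_r -> E x) :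
  w x u (\sum_i c i *: e i) = \sum_i c i * w x u (e i).
Proof.
rewrite form_skew form_suml -sumrN; apply: eq_bigr => i _.
by rewrite -mulrN -form_skew.
Qed.

Lemma formZ x (u v : E x) (c : R) : w x (c *: u) v = c * w x u v.
Proof.
by have := form_linear w c u 0 v; rewrite addr0 => ->;
  have := form_linear w 1 0 0 v; rewrite scale1r addr0 mul1r; lra.
Qed.

Hypothesis nd : nondegenerate w.

Lemma gram_unit (a : trivialization E r) (x : M) (c : R)
    (e : 'I_r -> E x) : tdom a x -> c != 0 ->
  (forall i, tmap a x (e i) = c *: delta_mx 0 i) ->
  (\matrix_(i, j) w x (e i) (e j)) \in unitmx.
Proof.
move=> ax c0 He; rewrite -row_free_unit; apply/row_freeP.
set A := \matrix_(i, j) _.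
suff /row_freeP : row_free A by [].
rewrite -kermx_eq0; apply/eqP/row_matrixP => k; rewrite row0.
set u := row k _.
have uA : u *m A = 0 by rewrite -row_mul mulmx_ker row0.
have z : \sum_i u 0 i *: e i = 0.
  apply: nd => v.
  have : w x (\sum_i u 0 i *: e i) (c *: v) = 0.
    rewrite (frame_span ax He) form_sumr big1 // => j _.
    rewrite form_suml; have /rowP /(_ j) := uA; rewrite !mxE => Hj.
    rewrite -[X in _ * X]/(\sum_i u 0 i * w x (e i) (e j)).
    under eq_bigr do rewrite -[w x _ _](mxE matrix_key (fun i j => w x (e i) (e j))).
    by rewrite Hj mulr0.
  rewrite form_skew formZ -mulrN -form_skew => /eqP.
  by rewrite mulf_eq0 (negbTE c0) => /eqP.
have : c *: u = 0.
  have : tmap a x (\sum_i u 0 i *: e i) = 0 by rewrite z linear0.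
  rewrite linear_sum => <-; rewrite [in LHS](row_sum_delta u) scaler_sumr.
  by apply: eq_bigr => i _; rewrite [in RHS]linearZ /= He !scalerA mulrC.
by move/eqP; rewrite scaler_eq0 (negbTE c0) => /eqP.
Qed.

Variable rho : anchor E.

Lemma grad_exists (f : Cinf M) :
  exists s : Gamma E, forall e, pairing w s e = anchor_act rho e f.
Proof.
have pt x : exists v : E x, forall u, w x v u = rho x u f.
  have [a ta ax] := trivs_cover E x.
  have [g [e [g1 ga He]]] := local_frame ta ax.
  have {}He i : tmap a x (e i x) = g x *: delta_mx 0 i by exact: He.
  have g0 : g x != 0 by rewrite g1 oner_neq0.
  have U := gram_unit ax g0 He.
  set A := \matrix_(i, j) _ in U.
  pose b := \row_j rho x (e j x) f.
  exists (\sum_i (b *m invmx A) 0 i *: e i x) => u.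
  have -> : u = \sum_i tmap a x u 0 i *: e i x.
    by rewrite -(frame_span ax He) g1 scale1r.
  rewrite form_sumr linear_sum /=.
  have -> : (\sum_i rho x (tmap a x u 0 i *: e i x)) f =
            \sum_i tmap a x u 0 i * rho x (e i x) f.
    elim/big_ind2: _ => //= [X y Y z <- <- //|i _].
    by rewrite linearZ.
  apply: eq_bigr => j _; congr (_ * _).
  rewrite form_suml.
  have : (b *m invmx A *m A) 0 j = b 0 j by rewrite mulmxKV.
  by rewrite mxE [b 0 j]mxE => <-; apply: eq_bigr => i _; rewrite [A i j]mxE.
pose s x := projT1 (cid (pt x)).
have sE x u : w x (s x) u = rho x u f := projT2 (cid (pt x)) u.
suff ss : ssmooth setT s.
  by exists (MkGamma ss) => e; apply: Cinf_ext => x /=.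
move=> a ta i; rewrite setIT; apply: msmooth_local => [|x0 ax0].
  exact: tdom_open.
have [g [e [g1 ga He]]] := local_frame ta ax0.
pose W := [set x | g x != 0].
have oW : open W.
  rewrite openE => x gx.
  have cg : {for x, continuous g} := msmooth_cont openT (cvalP g) I.
  exact: (cvgr_neq0 _ cg gx).
have W0 : W x0 by rewrite /W /= g1 oner_neq0.
pose A x := \matrix_(i, j) w x (e i x) (e j x).
pose b x := \row_j (g x * rho x (e j x) f).
have sA j k : msmooth W (fun x => A x j k).
  apply: (@msmooth_ext _ _ _ _ (pairing w (e j) (e k))) => //.
    by move=> x _; rewrite mxE.
  by apply: msmooth_sub (cvalP _).
have sb j : msmooth W (fun x => b x 0 j).
  apply: (@msmooth_ext _ _ _ _ (g * anchor_act rho (e j) f)) => //.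
    by move=> x _; rewrite mxE.
  by apply: msmooth_sub (cvalP _).
exists (fun x => (\det (A x))^-1 * \sum_j b x 0 j * \adj (A x) j i); last first.
  exists W => //; apply: msmoothM => //.
    apply: msmoothV => //; last exact: msmooth_det.
    move=> x gx; have := gram_unit (ga _ gx) gx (fun i => He x i (ga _ gx)).
    by rewrite unitmxE unitfE.
  by apply: msmooth_sum => // j; apply: msmoothM => //; exact: msmooth_adj.
apply: filterS (open_nbhs_nbhs (conj oW W0)) => x gx.
have ax := ga _ gx; have Hx j := He x j ax.
have U : A x \in unitmx := gram_unit ax gx Hx.
have E1 : tmap a x (s x) *m A x = b x.
  apply/rowP => j; rewrite mxE [RHS]mxE -sE -formZ (frame_span ax Hx) form_suml.
  by apply: eq_bigr => k _; rewrite [A x k j]mxE.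
have -> : tmap a x (s x) = b x *m invmx (A x) by rewrite -E1 mulmxK.
by rewrite /invmx U -scalemxAr [RHS]mxE; congr (_ * _); rewrite [RHS]mxE.
Qed.

Lemma gradP (f : Cinf M) (e : Gamma E) : pairing w (grad w rho f) e = anchor_act rho e f.
Proof. by move: e; rewrite /grad; case: xgetP => // /(_ _) H; have [s /H] := grad_exists f. Qed.

Lemma pairing_inj (s t : Gamma E) : (forall e, pairing w e s = pairing w e t) -> s = t.
Proof.
move=> st; apply: Gamma_ext => x; apply/eqP; rewrite -subr_eq0; apply/eqP.
apply: nd => v; have [e ev] := section_through v.
have := congr1 (fun f : Cinf M => f x) (st e) => /= H.
have L := form_linear_r (e x) (-1) (t x) (s x).
by rewrite addrC -scaleN1r form_skew -ev L /= -H /GRing.scale /= mulN1r addNr oppr0.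
Qed.

Lemma gradU (f : Cinf M) (s : Gamma E) :
  (forall e, pairing w s e = anchor_act rho e f) -> s = grad w rho f.
Proof.
move=> sf; apply: pairing_inj => e; apply: Cinf_ext => x /=.
by rewrite form_skew [RHS]form_skew; congr (- _);
   have := congr1 (fun h : Cinf M => h x) (etrans (sf e) (esym (gradP f e))).
Qed.

End LocalFrames.

Record lie_algebroid (R : realType) (n : nat) (M : manifold R n) (r : nat)
    (E : vbundle M r) := LieAlgebroid {
  bracket : Gamma E -> Gamma E -> Gamma E;
  lie_anchor : anchor E;
  bracket_linear_l : forall (a : R) (x y z : Gamma E),
    bracket (a *: x + y) z = a *: bracket x z + bracket y z;
  bracket_linear_r : forall (a : R) (x y z : Gamma E),
    bracket x (a *: y + z) = a *: bracket x y + bracket x z;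
  bracket_alt : forall x, bracket x x = 0;
  bracket_jacobi : forall x y z,
    bracket x (bracket y z) + bracket y (bracket z x)
      + bracket z (bracket x y) = 0;
  bracket_leibniz : forall x (f : Cinf M) y,
    bracket x (fscale f y)
      = fscale f (bracket x y) + fscale (anchor_act lie_anchor x f) y
}.

Record symplectic_lie_algebroid (R : realType) (n : nat) (M : manifold R n)
    (r : nat) (E : vbundle M r) := SymplecticLieAlgebroid {
  sla_lie :> lie_algebroid E;
  sla_form : form2 E;
  sla_nondegenerate : nondegenerate sla_form;
  sla_closed : let w := pairing sla_form in let rho := anchor_act (lie_anchor sla_lie) in
    let br := bracket sla_lie in
    forall x y z : Gamma E,
      rho x (w y z) - rho y (w x z) + rho z (w x y)
        - w (br x y) z + w (br x z) y - w (br y z) x = 0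
}.

Section Operations.
Variables (R : realType) (n : nat) (M : manifold R n) (r : nat).
Variable E : vbundle M r.
Variable mul : Gamma E -> Gamma E -> Gamma E.

Definition commutator (x y : Gamma E) : Gamma E := mul x y - mul y x.

Definition associator (x y z : Gamma E) : Gamma E :=
  mul x (mul y z) - mul (mul x y) z.

Definition Ttensor (w : form2 E) (x y z : Gamma E) : Cinf M :=
  pairing w (mul x y) z + pairing w x (mul y z)
    - pairing w (mul y x) z - pairing w y (mul x z).

End Operations.

Record presymplectic_algebroid (R : realType) (n : nat) (M : manifold R n)
    (r : nat) (E : vbundle M r) := PresymplecticAlgebroid {
  star : Gamma E -> Gamma E -> Gamma E;
  psa_anchor : anchor E;
  psa_form : form2 E;
  star_linear_l : forall (a : R) (x y z : Gamma E),
    star (a *: x + y) z = a *: star x z + star y z;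
  star_linear_r : forall (a : R) (x y z : Gamma E),
    star x (a *: y + z) = a *: star x y + star x z;
  psa_nondegenerate : nondegenerate psa_form;
  psa_associator : forall e1 e2 e3,
    associator star e1 e2 e3 - associator star e2 e1 e3
      = (6%:R^-1 : R) *:
          grad psa_form psa_anchor (Ttensor star psa_form e1 e2 e3);
  psa_invariance : forall e1 e2 e3,
    anchor_act psa_anchor e1 (pairing psa_form e2 e3)
      = pairing psa_form
          (star e1 e2
             - (2%:R^-1 : R) *:
                 grad psa_form psa_anchor (pairing psa_form e1 e2)) e3
        + pairing psa_form e2 (commutator star e1 e3)
}.

Section Corresponding.
Variables (R : realType) (n : nat) (M : manifold R n) (r : nat).
Variables (E : vbundle M r) (P : presymplectic_algebroid E).
Implicit Types x y z e : Gamma E.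

Let mul := star P.
Let w := psa_form P.
Let rho := psa_anchor P.
Let nd : nondegenerate w := @psa_nondegenerate _ _ _ _ _ P.
Let br := commutator mul.

Fact form_DZr p (u u' v : E p) (a : R) :
  w p v (a *: u + u') = a * w p v u + w p v u'.
Proof. by rewrite form_skew form_linear opprD -mulrN -!form_skew. Qed.

Fact formDl p (u u' v : E p) : w p (u + u') v = w p u v + w p u' v.
Proof. by have := form_linear w 1 u u' v; rewrite scale1r mul1r. Qed.

Fact formDr p (u u' v : E p) : w p v (u + u') = w p v u + w p v u'.
Proof. by have := form_DZr u u' v 1; rewrite scale1r mul1r. Qed.

Fact form0l p (v : E p) : w p 0 v = 0.
Proof. by have := formDl 0 0 v; rewrite addr0; lra. Qed.

Fact form0r p (v : E p) : w p v 0 = 0.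
Proof. by rewrite form_skew form0l oppr0. Qed.

Fact formSl p (u v : E p) (a : R) : w p (a *: u) v = a * w p u v.
Proof. by have := form_linear w a u 0 v; rewrite !addr0 form0l addr0. Qed.

Fact formSr p (u v : E p) (a : R) : w p v (a *: u) = a * w p v u.
Proof. by have := form_DZr u 0 v a; rewrite !addr0 form0r addr0. Qed.

Fact formNl p (u v : E p) : w p (- u) v = - w p u v.
Proof. by rewrite -scaleN1r formSl mulN1r. Qed.

Fact formNr p (u v : E p) : w p v (- u) = - w p v u.
Proof. by rewrite -scaleN1r formSr mulN1r. Qed.

Fact GammaN x p : (- x) p = - x p.
Proof. exact: scaleN1r. Qed.

Fact GammaD x y p : (x + y) p = x p + y p. Proof. by []. Qed.
Fact Gamma0E p : (0 : Gamma E) p = 0. Proof. by []. Qed.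
Fact GammaZ (a : R) x p : (a *: x) p = a *: x p. Proof. by []. Qed.
Fact fscaleE f x p : fscale f x p = f p *: x p. Proof. by []. Qed.
Fact CinfD (f g : Cinf M) p : (f + g) p = f p + g p. Proof. by []. Qed.
Fact CinfN (f : Cinf M) p : (- f) p = - f p. Proof. by []. Qed.
Fact Cinf0E p : (0 : Cinf M) p = 0. Proof. by []. Qed.
Fact CinfM (f g : Cinf M) p : (f * g) p = f p * g p. Proof. by []. Qed.
Fact CinfZ (a : R) (f : Cinf M) p : (a *: f) p = a * f p. Proof. by []. Qed.
Fact pairingE x y p : pairing w x y p = w p (x p) (y p). Proof. by []. Qed.

Definition ptE := (GammaN, GammaD, Gamma0E, GammaZ, fscaleE,
  CinfD, CinfN, Cinf0E, CinfM, CinfZ, pairingE, formDl, formDr, formNl, formNr,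
  formSl, formSr, form0l, form0r).

Fact starBl x y z : mul (x - y) z = mul x z - mul y z.
Proof.
have -> : x - y = (-1 : R) *: y + x by rewrite scaleN1r addrC.
by rewrite /mul star_linear_l scaleN1r addrC.
Qed.

Fact starBr x y z : mul z (x - y) = mul z x - mul z y.
Proof.
have -> : x - y = (-1 : R) *: y + x by rewrite scaleN1r addrC.
by rewrite /mul star_linear_r scaleN1r addrC.
Qed.

Fact actA e (f g : Cinf M) : anchor_act rho e (f + g) = anchor_act rho e f + anchor_act rho e g.
Proof.
apply: Cinf_ext => p /=; have := tval_linear (rho p (e p)) 1 f g.
by rewrite scale1r mul1r.
Qed.

Fact act0 e : anchor_act rho e 0 = 0.
Proof. by have := actA e 0 0; rewrite addr0 -[LHS]addr0 => /addrI. Qed.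

Fact actZ e (f : Cinf M) (a : R) : anchor_act rho e (a *: f) = a *: anchor_act rho e f.
Proof.
apply: Cinf_ext => p /=; have := tval_linear (rho p (e p)) a f 0.
by rewrite addr0 => ->; have /(congr1 (fun h : Cinf M => h p)) /= -> := act0 e; rewrite addr0.
Qed.

Fact act_fscale e (f g : Cinf M) : anchor_act rho (fscale f e) g = f * anchor_act rho e g.
Proof. by apply: Cinf_ext => p /=; rewrite linearZ. Qed.

Lemma actM e (f g : Cinf M) :
  anchor_act rho e (f * g) = anchor_act rho e f * g + f * anchor_act rho e g.
Proof. by apply: Cinf_ext => p /=; rewrite tval_leibniz. Qed.

Lemma psa_invariance_pt e1 e2 e3 p :
  anchor_act rho e1 (pairing w e2 e3) p = w p (mul e1 e2 p) (e3 p)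
    - 2%:R^-1 * anchor_act rho e3 (pairing w e1 e2) p + w p (e2 p) (br e1 e3 p).
Proof.
have := congr1 (fun h : Cinf M => h p) (psa_invariance P e1 e2 e3).
rewrite CinfD => ->; congr (_ + _); rewrite -(gradP nd rho).
by rewrite !ptE.
Qed.

Fact br_linear_l (a : R) x y z : br (a *: x + y) z = a *: br x z + br y z.
Proof.
rewrite /br /commutator /mul star_linear_l star_linear_r scalerBr opprD.
by rewrite addrACA.
Qed.

Fact br_linear_r (a : R) x y z : br x (a *: y + z) = a *: br x y + br x z.
Proof.
rewrite /br /commutator /mul star_linear_l star_linear_r scalerBr opprD.
by rewrite addrACA.
Qed.

Fact br_alt x : br x x = 0.
Proof. exact: subrr. Qed.

Fact br_jacobi x y z : br x (br y z) + br y (br z x) + br z (br x y) = 0.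
Proof.
have H e1 e2 e3 e p :
    w p (e p) ((associator mul e1 e2 e3 - associator mul e2 e1 e3) p)
    = - (6%:R^-1 * anchor_act rho e (Ttensor mul w e1 e2 e3) p).
  rewrite psa_associator !ptE -(gradP nd rho) /= [in RHS]form_skew; lra.
apply: (pairing_inj nd) => e; apply: Cinf_ext => p /=.
have := (H x y z e p, H y z x e p, H z x y e p).
rewrite /br /commutator /associator !(starBl, starBr) !ptE => -[[h1 h2] h3].
have : anchor_act rho e (Ttensor mul w x y z + Ttensor mul w y z x
                  + Ttensor mul w z x y) p = 0.
  have -> : Ttensor mul w x y z + Ttensor mul w y z x + Ttensor mul w z x y = 0.
    apply: Cinf_ext => q; rewrite /Ttensor !ptE /=.
    rewrite !(form_skew w (x q) (mul _ _ q)) !(form_skew w (y q) (mul _ _ q)).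
    by rewrite !(form_skew w (z q) (mul _ _ q)); ring.
  by rewrite act0.
rewrite 2!actA !ptE; lra.
Qed.

Fact br_leibniz x (f : Cinf M) y :
  br x (fscale f y) = fscale f (br x y) + fscale (anchor_act rho x f) y.
Proof.
apply: (pairing_inj nd) => e; apply: Cinf_ext => p.
have h1 := psa_invariance_pt x e (fscale f y) p.
have h2 := psa_invariance_pt x e y p.
have e1 : pairing w e (fscale f y) = f * pairing w e y.
  by apply: Cinf_ext => q /=; rewrite !ptE.
move: h1; rewrite e1 actM act_fscale !ptE h2 /br /commutator !ptE; lra.
Qed.

Fact br_closed x y z :
  anchor_act rho x (pairing w y z) - anchor_act rho y (pairing w x z) + anchor_act rho z (pairing w x y)
    - pairing w (br x y) z + pairing w (br x z) y - pairing w (br y z) x = 0.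
Proof.
apply: Cinf_ext => p.
have h1 := psa_invariance_pt x y z p.
have h2 := psa_invariance_pt y x z p.
have e1 : pairing w y x = (-1 : R) *: pairing w x y.
  by apply: Cinf_ext => q; rewrite !ptE form_skew mulN1r.
rewrite !ptE h1 h2 e1 actZ !ptE.
by rewrite !(form_skew w (y p)) !(form_skew w (x p)); lra.
Qed.

Definition corresponding_lie_algebroid : lie_algebroid E :=
  LieAlgebroid br_linear_l br_linear_r br_alt br_jacobi br_leibniz.

Definition corresponding : symplectic_lie_algebroid E :=
  @SymplecticLieAlgebroid _ _ _ _ _ corresponding_lie_algebroid w nd br_closed.

End Corresponding.

Section Subbundles.
Variables (R : realType) (n : nat) (M : manifold R n) (r : nat).
Variable E : vbundle M r.

(* A subbundle is given by its fibres, which locally are spanned by a smooth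
   frame; its rank k is constant. *)
Record subbundle := Subbundle {
  subfib :> forall x, set (E x);
  subbundle_frame : exists k : nat, forall x0 : M,
    exists (W : set M) (s : 'I_k -> forall x, E x),
      [/\ open W, W x0, forall i, ssmooth W (s i) &
       forall x, W x ->
         (forall c : 'I_k -> R, \sum_i c i *: s i x = 0 -> forall i, c i = 0) /\
         @subfib x = [set v | exists c : 'I_k -> R, v = \sum_i c i *: s i x]]
}.

Arguments subfib _ x v : clear implicits.

Definition section_of (F : subbundle) (e : Gamma E) := forall x, F x (e x).

Definition linear_subspace (x : M) (A : set (E x)) :=
  A 0 /\ forall (a : R) u v, A u -> A v -> A (a *: u + v).

Definition isotropic (w : form2 E) (x : M) (A : set (E x)) :=
  forall u v, A u -> A v -> w x u v = 0.

(* Maximality is fibrewise: F_x is a maximal isotropic subspace of E_x for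
   every x, and not merely maximal among the isotropic subbundles. *)
Definition maximal_isotropic (w : form2 E) (F : subbundle) :=
  forall x, isotropic w (F x) /\
    forall A : set (E x), linear_subspace A -> isotropic w A ->
      F x `<=` A -> A = F x.

Definition is_subalgebroid (L : lie_algebroid E) (F : subbundle) :=
  forall e1 e2, section_of F e1 -> section_of F e2 ->
    section_of F (bracket L e1 e2).

(* The bracket and the anchor of a subalgebroid are the restricted ones, so
   that a subalgebroid is determined by its underlying subbundle. *)
Record lagrangian_subalgebroid (S : symplectic_lie_algebroid E) :=
  LagrangianSubalgebroid {
    lag_sub :> subbundle;
    lag_subalgebroid : is_subalgebroid S lag_sub;
    lag_maximal : maximal_isotropic (sla_form S) lag_sub
  }.

Record dirac_structure (P : presymplectic_algebroid E) := DiracStructure {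
  dirac_sub :> subbundle;
  dirac_maximal : maximal_isotropic (psa_form P) dirac_sub;
  dirac_integrable : forall e1 e2, section_of dirac_sub e1 ->
    section_of dirac_sub e2 -> section_of dirac_sub (star P e1 e2)
}.

End Subbundles.
Arguments subfib {R n M r E} _ x v.

(* Main.v *)
Require Import Defs.
From mathcomp Require Import all_boot all_order all_algebra.
From mathcomp Require Import all_classical all_reals all_analysis.
From mathcomp Require Import ring lra.

(** A Dirac structure and a Lagrangian subalgebroid are both maximally isotropic
    subbundles [F], so the bijection is the identity on subbundles; what has to
    be shown is that such an [F] is closed under the product [star] iff it is
    closed under the commutator.  One direction is immediate because fibres are
    linear subspaces.  For the other, evaluate the invariance axiom
      rho(e1)(e2,e3) = (e1 * e2, e3) - 1/2 rho(e3)(e1,e2) + (e2, [e1,e3])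
    on sections of [F]: the two derivatives are those of the zero function and
    [e1,e3] is again a section of [F], so only (e1 * e2, e3) = 0 survives
    (lemma [star_orthogonal]).  This says that e1 * e2 is pointwise orthogonal
    to [F], since every vector of [F] extends to a global section of [F]
    (lemma [subbundle_section_through], by a bump function), and a maximal
    isotropic subspace contains every vector orthogonal to it
    (lemma [maximal_isotropic_orthogonal]). *)

Set Implicit Arguments.
Unset Strict Implicit.
Unset Printing Implicit Defensive.

Import Order.TTheory GRing.Theory Num.Theory.

Local Open Scope classical_set_scope.
Local Open Scope ring_scope.

Section SubbundleSections.
Variables (R : realType) (n : nat) (M : manifold R n) (r : nat).
Variable E : vbundle M r.

Lemma ssmooth_sum (W : set M) (k : nat) (c : 'I_k -> R)
    (s : 'I_k -> forall x, E x) : open W ->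
  (forall i, ssmooth W (s i)) -> ssmooth W (fun x => \sum_i c i *: s i x).
Proof.
move=> oW ss a ta j.
have oV : open (tdom a `&` W) by apply: openI => //; exact: tdom_open.
apply: (@msmooth_ext _ _ _ _ (fun x => \sum_i c i * tmap a x (s i x) 0 j)) => //.
  move=> x _; rewrite linear_sum summxE; apply: eq_bigr => i _.
  by rewrite linearZ mxE.
by apply: msmooth_sum => // i; apply: msmoothM => //;
   [exact: msmooth_cst|exact: ss].
Qed.

(** Near a point outside the support of the bump function the product vanishes,
    and the support is a closed subset of [W]; hence the product is smooth
    whatever the values of [s] outside [W]. *)
Lemma bump_section (W : set M) (x0 : M) (s : forall x, E x) :
  open W -> W x0 -> ssmooth W s ->
  exists (f : M -> R) (e : Gamma E),
    [/\ f x0 = 1, forall x, f x != 0 -> W x & forall x, e x = f x *: s x].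
Proof.
move=> oW Wx0 ss; have [f [K [cK KW] [sf f1 fK]]] := smooth_bump oW Wx0.
suff se : ssmooth setT (fun x => f x *: s x).
  by exists f, (MkGamma se); split=> // x /fK /KW.
move=> a ta i; rewrite setIT; apply: msmooth_local => [|x ax].
  exact: tdom_open.
have [Wx|nWx] := pselect (W x).
  have oV : open (tdom a `&` W) by apply: openI => //; exact: tdom_open.
  exists (fun y => f y * tmap a y (s y) 0 i).
    by apply: nearW => y; rewrite linearZ mxE.
  exists (tdom a `&` W) => //; apply: msmoothM => //; last exact: ss.
  exact: msmooth_sub sf.
exists (fun=> 0); last first.
  by exists setT; [split=> //; exact: openT|exact: msmooth_cst].
have nK : ~ K x by move=> /KW.
apply: filterS (open_nbhs_nbhs (conj (closed_openC cK) nK)) => y Ky.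
have -> : f y = 0 by apply/eqP; apply: contra_notT Ky; exact: fK.
by rewrite scale0r linear0 mxE.
Qed.

Lemma subbundle_linear (F : subbundle E) x : linear_subspace (F x).
Proof.
have [k /(_ x) [W [s [_ Wx _ /(_ x Wx) [_ ->]]]]] := subbundle_frame F.
split.
  by exists (fun=> 0); rewrite big1 // => i _; rewrite scale0r.
move=> a _ _ [c ->] [d ->]; exists (fun i => a * c i + d i).
rewrite scaler_sumr -big_split; apply: eq_bigr => i _.
by rewrite scalerDl scalerA.
Qed.

Lemma subbundleZ (F : subbundle E) x (a : R) (u : E x) : F x u -> F x (a *: u).
Proof.
have [F0 FD] := subbundle_linear F x.
by move=> Fu; rewrite -[X in F x X]addr0; exact: FD.
Qed.

Lemma subbundleB (F : subbundle E) x (u v : E x) : F x u -> F x v -> F x (u - v).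
Proof.
have [_ FD] := subbundle_linear F x.
by move=> Fu Fv; rewrite addrC -scaleN1r; exact: FD.
Qed.

(** The constant-coefficient combination of a local frame of [F] through [v]
    becomes global once it is cut off by a bump function. *)
Lemma subbundle_section_through (F : subbundle E) x0 (v : E x0) : F x0 v ->
  exists2 e : Gamma E, section_of F e & e x0 = v.
Proof.
have [k /(_ x0) [W [s [oW Wx0 ss Fs]]]] := subbundle_frame F.
rewrite (Fs _ Wx0).2 => -[c vE].
have [f [e [f1 fW eE]]] := bump_section oW Wx0 (ssmooth_sum c oW ss).
exists e; last by rewrite eE f1 scale1r.
move=> x; rewrite eE; have [->|/fW Wx] := eqVneq (f x) 0.
  by rewrite scale0r; exact: (subbundle_linear F x).1.
by apply: subbundleZ; rewrite (Fs _ Wx).2; exists c.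
Qed.

(** If [u] is orthogonal to [F x], the span of [F x] and [u] is still isotropic,
    because a skew form vanishes at [(u, u)]; by maximality it is [F x]. *)
Lemma maximal_isotropic_orthogonal (w : form2 E) (F : subbundle E) x (u : E x) :
  maximal_isotropic w F -> (forall v, F x v -> w x u v = 0) -> F x u.
Proof.
move=> /(_ x) [iF maxF] uF; have [F0 FD] := subbundle_linear F x.
pose A : set (E x) := [set y | exists a : R, exists2 v, F x v & y = a *: u + v].
have inA (a : R) v : F x v -> A (a *: u + v) by move=> Fv; exists a, v.
have uu : w x u u = 0 by have := form_skew w u u; lra.
suff <- : A = F x by rewrite -[u]addr0 -[X in X + _]scale1r; exact: inA.
apply: maxF => [||v Fv]; last by have := inA 0 v Fv; rewrite scale0r add0r.
- split; first by have := inA 0 0 F0; rewrite scale0r add0r.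
  move=> a _ _ [b [y Fy ->]] [c [z Fz ->]].
  rewrite scalerDr scalerA addrACA -scalerDl.
  by apply: inA; exact: FD.
- move=> _ _ [b [y Fy ->]] [c [z Fz ->]].
  have yu : w x y u = 0 by rewrite form_skew uF ?oppr0.
  have zu : w x u z = 0 by exact: uF.
  have E1 (t : E x) : w x (c *: u + z) t = c * w x u t + w x z t.
    exact: form_linear.
  rewrite form_linear (form_skew w u) (form_skew w y) !E1 uu.
  by rewrite (uF y Fy) (form_skew w z) zu (iF z y Fz Fy); ring.
Qed.

End SubbundleSections.

Section DiracLagrangian.
Variables (R : realType) (n : nat) (M : manifold R n) (r : nat).
Variables (E : vbundle M r) (P : presymplectic_algebroid E).

Lemma star_orthogonal (F : subbundle E) (e1 e2 e3 : Gamma E) :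
  (forall x, isotropic (psa_form P) (F x)) ->
  is_subalgebroid (corresponding P) F ->
  section_of F e1 -> section_of F e2 -> section_of F e3 ->
  forall x, psa_form P x (star P e1 e2 x) (e3 x) = 0.
Proof.
move=> iF sF F1 F2 F3 x.
have p0 e e' : section_of F e -> section_of F e' ->
    pairing (psa_form P) e e' = 0.
  by move=> Fe Fe'; apply: Cinf_ext => y; exact: iF.
have := psa_invariance_pt P e1 e2 e3 x.
rewrite !p0 // !act0 (iF x _ _ (F2 x) (sF _ _ F1 F3 x)).
by rewrite [X in X = _]/= [X in _ * X]/= mulr0 subr0 addr0 => <-.
Qed.

Lemma lagrangian_star_closed (L : lagrangian_subalgebroid (corresponding P))
    (e1 e2 : Gamma E) : section_of (lag_sub L) e1 -> section_of (lag_sub L) e2 ->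
  section_of (lag_sub L) (star P e1 e2).
Proof.
move=> L1 L2 x; have mL := lag_maximal L.
apply: (maximal_isotropic_orthogonal mL) => _ /subbundle_section_through[e3 L3 <-].
apply: star_orthogonal L1 L2 L3 x; last exact: lag_subalgebroid.
by move=> y; have [] := mL y.
Qed.

Lemma dirac_commutator_closed (F : dirac_structure P) :
  is_subalgebroid (corresponding P) (dirac_sub F).
Proof.
move=> e1 e2 F1 F2 x; rewrite -[bracket _ _ _]/(star P e1 e2 - star P e2 e1).
by rewrite GammaD GammaN; apply: subbundleB; exact: dirac_integrable.
Qed.

Definition lagrangian_of_dirac (F : dirac_structure P) :=
  @LagrangianSubalgebroid _ _ _ _ _ (corresponding P) (dirac_sub F)
    (@dirac_commutator_closed F) (dirac_maximal F).

Definition dirac_of_lagrangian (L : lagrangian_subalgebroid (corresponding P)) :=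
  @DiracStructure _ _ _ _ _ P (lag_sub L) (lag_maximal L)
    (@lagrangian_star_closed L).

End DiracLagrangian.

Theorem proposition3p17 (R : realType) (n : nat) (M : manifold R n) (r : nat)
    (E : vbundle M r) (P : presymplectic_algebroid E) :
  exists phi : dirac_structure P -> lagrangian_subalgebroid (corresponding P),
    bijective phi /\
    (forall F : dirac_structure P, lag_sub (phi F) = dirac_sub F).
Proof.
exists (@lagrangian_of_dirac _ _ _ _ _ P); split=> //.
(* Both composites keep the subbundle and change only proofs. *)
exists (@dirac_of_lagrangian _ _ _ _ _ P) => -[F p q].
- by congr DiracStructure; exact: Prop_irrelevance.
- by congr LagrangianSubalgebroid; exact: Prop_irrelevance.
Qed.
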